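(* Let $G$ be a graph of order $n$ such that $n\not\equiv 2\pmod 4$. If $G$ is Hamiltonian, then $G$ has a neighborhood-prime labeling.
   Context: All graphs are finite and simple; the order of $G$ is $|V(G)|$; $[n]=\{1,\dots,n\}$; $N(v)$ is the set of neighbors of $v$. A neighborhood-prime labeling of a graph $G$ of order $n$ is a bijection $f:V(G)\to[n]$ such that for every vertex $v\in V(G)$ of degree greater than $1$, $\gcd\{f(u):u\in N(v)\}=1$. A graph is Hamiltonian if it contains a cycle through all of its vertices. *)

(* Defs.v *)
From mathcomp Require Import all_boot.

Set Implicit Arguments.
Unset Strict Implicit.
Unset Printing Implicit Defensive.

(* A finite simple graph is a finType T of vertices with a symmetric
   irreflexive adjacency relation e : rel T; its order is #|T|. *)

Definition neighbors (T : finType) (e : rel T) (v : T) : {set T} :=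
  [set u | e v u].

Definition degree (T : finType) (e : rel T) (v : T) : nat := #|neighbors e v|.

(* [ucycle] also accepts the empty sequence, and a single edge x - y as
   [:: x; y]; a cycle of a simple graph has at least three vertices. *)
Definition is_graph_cycle (T : finType) (e : rel T) (c : seq T) : Prop :=
  2 < size c /\ ucycle e c.

Definition hamiltonian (T : finType) (e : rel T) : Prop :=
  exists c : seq T, is_graph_cycle e c /\ forall v : T, v \in c.

Definition bijection_to_initial (T : finType) (f : T -> nat) (n : nat) : Prop :=
  injective f /\ forall k : nat, 1 <= k <= n <-> exists v : T, f v = k.

(* 0 is neutral for gcdn, so the big operator is the gcd of the set of labels. *)
Definition neighborhood_prime_labeling (T : finType) (e : rel T) (f : T -> nat)
    : Prop :=
  bijection_to_initial f #|T| /\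
  forall v : T, 1 < degree e v -> \big[gcdn/0]_(u in neighbors e v) f u = 1.

(* Main.v *)
Require Import Defs.
From mathcomp Require Import all_boot.
From mathcomp Require Import zify.

(** Along a Hamiltonian cycle [c_0, ..., c_(n-1)] (indices mod [n]), the vertex
    [c_(i+1)] is adjacent to both [c_i] and [c_(i+2)].  The gcd over a whole
    neighborhood divides the gcd of any two of its labels, so it is enough that
    vertices two steps apart on the cycle carry coprime labels; the chords of
    the graph are irrelevant.

    Walk the cycle in steps of two and number the vertices consecutively,
    first those at even positions, then those at odd positions
    ([two_step_label]).  Labels two steps apart are then consecutive integers,
    except where the walk wraps around.
    - Position [n-2] is followed by position [0], whose label is [1].
    - Position [n-1] is followed by position [1].  If [n] is odd, the walk just
      passes from the last even position to the first odd one, and the labels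
      are again consecutive.  If [n = 2m], the labels are [2m] and [m+1], whose
      gcd divides [2(m+1) - 2m = 2]; it is [1] exactly when [m] is even, and
      this is where [n] must not be [2] mod [4] ([coprime_two_step_label]). *)

Definition two_step_label (n i : nat) : nat :=
  (i./2 + (if odd i then uphalf n else 0)).+1.

Lemma two_step_label_inj n i j :
  i < n -> j < n -> two_step_label n i = two_step_label n j -> i = j.
Proof.
by rewrite /two_step_label => lt_in lt_jn; case: ifP; case: ifP; lia.
Qed.

Lemma two_step_label_bounds n i : i < n -> 1 <= two_step_label n i <= n.
Proof. by rewrite /two_step_label => lt_in; case: ifP; lia. Qed.

Lemma two_step_label_surj n k :
  1 <= k <= n -> exists2 i, i < n & two_step_label n i = k.
Proof.
move=> k_bounds; have [k_le|k_gt] := leqP k (uphalf n).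
  by exists (k.-1).*2; rewrite /two_step_label ?odd_double ?doubleK; lia.
exists ((k - uphalf n).-1).*2.+1; first by lia.
by rewrite /two_step_label /= odd_double /= uphalf_double; lia.
Qed.

(** Labels two steps apart are consecutive until the walk wraps around; the
    wrap-around from position [n-1] to position [1] is the only place where the
    residue of [n] mod [4] matters. *)
Lemma coprime_two_step_label n i : 2 < n -> n <> 2 %[mod 4] -> i < n ->
  coprime (two_step_label n i) (two_step_label n (i.+2 %% n)).
Proof.
move=> n_gt2 n_mod4 lt_in; have [lt_i2n|le_ni2] := ltnP i.+2 n.
  rewrite modn_small // /two_step_label /= negbK -addSn.
  exact: coprimenS.
have [i_eq|i_eq] : i.+2 = n \/ i.+2 = n.+1 by lia.
  by rewrite i_eq modnn; apply: coprimen1.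
rewrite i_eq -addn1 modnDl modn_small; last by lia.
have -> : two_step_label n 1 = (uphalf n).+1 by [].
have [n_odd|n_even] := boolP (odd n).
  have -> : two_step_label n i = uphalf n.
    by rewrite /two_step_label; case: ifP; lia.
  exact: coprimenS.
have -> : two_step_label n i = (uphalf n).*2.
  by rewrite /two_step_label; case: ifP; lia.
(* [m+1] is odd, hence coprime to [2], and consecutive to [m]. *)
rewrite -muln2 coprimeMl coprimenS coprime2n /=.
by lia.
Qed.

Lemma index_next (T : eqType) (c : seq T) (x : T) :
  uniq c -> x \in c -> index (next c x) c = (index x c).+1 %% size c.
Proof.
move=> c_uniq x_in; rewrite next_nth x_in.
case: c c_uniq x_in => // y p c_uniq x_in.
have: index x (y :: p) < size (y :: p) by rewrite index_mem.
rewrite [size _]/= ltnS leq_eqVlt => /orP[/eqP->|lt_ip].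
  by rewrite modnn nth_default //= eqxx.
rewrite modn_small ?ltnS //.
by rewrite -[nth y p _]/(nth y (y :: p) (index x (y :: p)).+1) index_uniq.
Qed.

Lemma biggcdn_eq1_of_coprime {T : finType} {A : {set T}} {f : T -> nat} (u w : T) :
  u \in A -> w \in A -> coprime (f u) (f w) ->
  \big[gcdn/0]_(x in A) f x = 1.
Proof.
move=> uA wA /eqP co_uw; apply/eqP; rewrite -dvdn1 -co_uw dvdn_gcd.
by rewrite (biggcdn_inf u) // (biggcdn_inf w).
Qed.

Theorem theorem1 (T : finType) (e : rel T) (n : nat)
    (e_sym : symmetric e) (e_irr : irreflexive e)
    (order_n : #|T| = n) (n_mod4 : n <> 2 %[mod 4]) :
  hamiltonian e ->
  exists f : T -> nat, neighborhood_prime_labeling e f.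
Proof.
case=> c [[c_gt2 /andP[c_cycle c_uniq]] c_all].
have size_c : size c = n.
  by rewrite -order_n -(card_uniqP c_uniq); apply: eq_card => v; rewrite c_all.
have index_lt v : index v c < n by rewrite -size_c index_mem.
exists (fun v => two_step_label n (index v c)); split; last first.
  move=> v _; apply: (biggcdn_eq1_of_coprime (prev c v) (next c v)).
  - by rewrite inE e_sym (prev_cycle c_cycle).
  - by rewrite inE (next_cycle c_cycle).
  set u := prev c v; have -> : v = next c u by rewrite next_prev.
  rewrite !index_next // size_c -(addn1 (_ %% n)) modnDml addn1.
  by apply: coprime_two_step_label; rewrite // -size_c.
split.
  move=> v w /two_step_label_inj eq_index.
  by apply: (index_inj v (c_all v) (c_all w)); apply: eq_index.
move=> k; rewrite order_n; split; last first.
  by case=> v <-; apply: two_step_label_bounds.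
case/two_step_label_surj=> i lt_in <-.
case: c size_c c_uniq {c_gt2 c_cycle c_all index_lt} => [|x p] size_c c_uniq.
  by rewrite -size_c in lt_in.
by exists (nth x (x :: p) i); rewrite index_uniq ?size_c.
Qed.
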